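(* Let $y,z\in H^{<}$ and let $(-\infty,L]^2$ and $[R,+\infty)^2$ be, respectively, the initial box and the final box given by $y$ and $z$. Then there is $g\in H$ with $g^{-1}yg=z$ if and only if there is some $(a^2,ab)\in\mathrm{Aff}(\mathbb{R})$ (with $a,b\in\mathbb{R}$, $a\neq 0$) with $a^2L+ab\le L$ such that the pointwise limit $$t\mapsto\lim_{N\to\infty}y^{-N}g_0z^{N}(t)$$ exists in $\mathbb{R}$ for every $t\in\mathbb{R}$ and is affine inside $[R,+\infty)^2$, where $g_0\in H$ is an arbitrary homeomorphism which is affine on $(-\infty,L]^2$ and has initial germ $(g_0)_{-\infty}=(a^2,ab)$.
   Context: Monod's group $H=H(\mathbb{R})$: the group, under composition, of all homeomorphisms $f$ of $\mathbb{R}\mathrm{P}^1=\mathbb{R}\cup\{\infty\}$ with $f(\infty)=\infty$ for which there are finitely many real points $t_0<\dots<t_n$ such that on each of $(-\infty,t_0]$, $[t_i,t_{i+1}]$, $[t_n,+\infty)$ the map $f$ coincides with a Möbius transformation $t\mapsto\frac{at+b}{ct+d}$, $a,b,c,d\in\mathbb{R}$, $ad-bc=1$. Elements of $H$ are regarded as increasing homeomorphisms of $\mathbb{R}$; they are affine near $\pm\infty$. Products are compositions: $fg(t)=f(g(t))$. $H^{<}=\{g\in H\mid g(t)<t \text{ for all } t\in\mathbb{R}\}$. $\mathrm{Aff}(\mathbb{R})=\mathbb{R}_{>0}\ltimes\mathbb{R}$ with $(a,b)(c,d)=(ac,b+ad)$. If $g\in H$ satisfies $g(t)=\alpha t+\beta$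 for all sufficiently negative $t$, its initial germ is $g_{-\infty}=(\alpha,\beta)\in\mathrm{Aff}(\mathbb{R})$. An initial box given by $y,z$ is $(-\infty,L]^2$ where $L\in\mathbb{R}$ is such that $y$ and $z$ are both affine with the same slope on $(-\infty,L]$; a final box given by $y,z$ is $[R,+\infty)^2$ where $R\in\mathbb{R}$ is such that $y$ and $z$ are both affine with the same slope on $[R,+\infty)$. (Thus the existence of these boxes presupposes that $y$ and $z$ have the same slopes near $-\infty$ and near $+\infty$.) A map $g$ is affine on (inside) $(-\infty,L]^2$ if it is affine on $\{t\le L\mid g(t)\le L\}$, and affine inside $[R,+\infty)^2$ if it is affine on $\{t\ge R\mid g(t)\ge R\}$. *)

(* Defs.v *)
From mathcomp Require Export all_boot all_order all_algebra.
From mathcomp Require Export all_classical all_reals all_analysis.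
Export numFieldNormedType.Exports.

Set Implicit Arguments.
Unset Strict Implicit.
Unset Printing Implicit Defensive.

Import Order.TTheory GRing.Theory Num.Theory.

Local Open Scope classical_set_scope.
Local Open Scope ring_scope.

(* RP^1 = R + {oo}: [Some t] is the real point t and [None] is oo *)
Definition RP1 (R : realType) := one_point_compactification R.

Definition mobius (R : realType) (a b c d : R) (x : RP1 R) : RP1 R :=
  match x with
  | Some t => if c * t + d == 0 then None else Some ((a * t + b) / (c * t + d))
  | None => if c == 0 then None else Some (a / c)
  end.

Definition mobius_on (R : realType) (F : RP1 R -> RP1 R) (I : set R) : Prop :=
  exists a b c d : R, a * d - b * c = 1 /\
    forall t : R, I t -> F (Some t) = mobius a b c d (Some t).

(* only the values t 0, ..., t n of the sequence t matter *)
Definition piecewise_mobius (R : realType) (F : RP1 R -> RP1 R) : Prop :=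
  exists (n : nat) (t : nat -> R),
    [/\ forall i, (i < n)%N -> t i < t i.+1,
        mobius_on F [set x | x <= t 0%N],
        forall i, (i < n)%N -> mobius_on F [set x | t i <= x <= t i.+1] &
        mobius_on F [set x | t n <= x] ].

Definition homeomorphism (T U : topologicalType) (F : T -> U) : Prop :=
  continuous F /\
  exists G : U -> T, [/\ continuous G, cancel F G & cancel G F].

(* The self-maps of RP^1 fixing oo and preserving the real points are exactly
   the maps [ext f]. *)
Definition ext (R : realType) (f : R -> R) : RP1 R -> RP1 R :=
  fun x => if x is Some t then Some (f t) else None.

(* A homeomorphism of RP^1 fixing oo is represented by its restriction to the
   real line. *)
Definition monodH (R : realType) : set (R -> R) :=
  [set f | homeomorphism (ext f) /\ piecewise_mobius (ext f)].

Definition monodH_lt (R : realType) : set (R -> R) :=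
  [set g | monodH g /\ forall t : R, g t < t].

(* the genuine two-sided inverse for bijective f, hence for f in [monodH] *)
Definition finv (R : realType) (f : R -> R) : R -> R := pinv [set: R] f.

Definition Aff (R : realType) : set (R * R) := [set p | 0 < p.1].

Definition has_initial_germ (R : realType) (g : R -> R) (p : R * R) : Prop :=
  Aff p /\ \forall t \near -oo, g t = p.1 * t + p.2.

Definition affine_same_slope_on (R : realType) (I : set R) (y z : R -> R) :
    Prop :=
  exists s by_ bz : R,
    forall t : R, I t -> y t = s * t + by_ /\ z t = s * t + bz.

Definition lower_square (R : realType) (L : R) : set (R * R) :=
  `]-oo, L] `*` `]-oo, L].
Definition upper_square (R : realType) (r : R) : set (R * R) :=
  `[r, +oo[ `*` `[r, +oo[.

(* [lower_square L] is an initial box given by y and z *)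
Definition initial_box (R : realType) (y z : R -> R) (L : R) : Prop :=
  affine_same_slope_on `]-oo, L] y z.

(* [upper_square r] is a final box given by y and z *)
Definition final_box (R : realType) (y z : R -> R) (r : R) : Prop :=
  affine_same_slope_on `[r, +oo[ y z.

(* affine on the set of points over which the graph of g lies in B *)
Definition affine_inside (R : realType) (B : set (R * R)) (g : R -> R) : Prop :=
  exists c d : R, forall t : R, B (t, g t) -> g t = c * t + d.

(* the sequence N |-> y^{-N} g0 z^N (t) *)
Definition conj_seq (R : realType) (y g0 z : R -> R) (t : R) : nat -> R :=
  fun N => iter N (finv y) (g0 (iter N z t)).

(* Main.v *)
Require Import Defs.
From mathcomp Require Import ring lra.

Set Implicit Arguments.
Unset Strict Implicit.
Unset Printing Implicit Defensive.

Import Order.TTheory GRing.Theory Num.Theory.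
Local Open Scope classical_set_scope.
Local Open Scope ring_scope.

(** A conjugator [g] satisfies [g z = y g], hence [g = y^-N g z^N] for all [N]:
    since [z^N t] tends to -oo, [g] is recovered from its germ at -oo as the
    pointwise limit of [y^-N g0 z^N], where the sequence is eventually constant.
    The same relation, read backwards along the orbits [z^-N t] inside the final
    box, spreads the affinity of [g] near +oo to the whole box.

    Conversely the limit [gam] for [g0] affine satisfies [gam z = y gam].  Near
    -oo the approximants are affine with the slope of [g0], so [gam] is affine
    there, and [gam = y^-n gam z^n] shows that it is piecewise Moebius on every
    half-line bounded above; affinity in the final box bounds the number of
    pieces. *)

(** * Moebius maps on subsets of the line, and piecewise Moebius maps *)

Section Mobius.
Context {R : realType}.
Implicit Types (f g : R -> R) (I J : set R) (s : seq R).

(** [ext f] sends real points to real points, which excludes the pole case of [mobius]. *)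
Lemma mobius_onP f I : mobius_on (ext f) I <->
  exists a b c d : R, a * d - b * c = 1 /\
    forall t, I t -> c * t + d != 0 /\ f t = (a * t + b) / (c * t + d).
Proof.
split=> -[a [b [c [d [det h]]]]]; exists a, b, c, d; split=> // t /h /=.
  by case: ifP => // /negbT ? [].
by move=> [/negPf -> ->].
Qed.

Lemma mobius_on_sub f I J : I `<=` J -> mobius_on (ext f) J -> mobius_on (ext f) I.
Proof.
by move=> IJ [a [b [c [d [det h]]]]]; exists a, b, c, d; split=> // t /IJ /h.
Qed.

Lemma mobius_on_eq f g I : {in I, f =1 g} ->
  mobius_on (ext f) I -> mobius_on (ext g) I.
Proof.
move=> fg [a [b [c [d [det h]]]]]; exists a, b, c, d; split=> // t It.
by rewrite -h //= fg // inE.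
Qed.

Lemma mobius_on_comp f g I : mobius_on (ext g) I ->
  mobius_on (ext f) (g @` I) -> mobius_on (ext (f \o g)) I.
Proof.
move=> /mobius_onP[a' [b' [c' [d' [det' hg]]]]].
move=> /mobius_onP[a [b [c [d [det hf]]]]]; apply/mobius_onP.
(* These are the entries of the matrix product, so determinants multiply. *)
exists (a * a' + b * c'), (a * b' + b * d'), (c * a' + d * c'), (c * b' + d * d').
split.
  transitivity ((a * d - b * c) * (a' * d' - b' * c')); first by ring.
  by rewrite det det' mulr1.
move=> t It; have [ng eg] := hg t It.
have [] := hf (g t); first by exists t.
rewrite eg /= eg => nf ->.
have E : (c * a' + d * c') * t + (c * b' + d * d') =
  (c * ((a' * t + b') / (c' * t + d')) + d) * (c' * t + d') by field.
split; first by rewrite E mulf_neq0.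
field; rewrite ng /= andbT; move: nf; apply: contra_neq => e.
by apply: (mulIf ng); rewrite mul0r -e; field.
Qed.

Lemma mobius_on_inv f g I : cancel g f ->
  mobius_on (ext f) (g @` I) -> mobius_on (ext g) I.
Proof.
move=> gK /mobius_onP[a [b [c [d [det hf]]]]]; apply/mobius_onP.
(* The inverse matrix; by [E] below, the denominators of the two maps are inverse to each other. *)
exists d, (- b), (- c), a; split; first by rewrite -det; ring.
move=> t It; have [nf] := hf (g t) (ex_intro2 _ _ t It erefl).
rewrite gK => e.
have e' : t * (c * g t + d) = a * g t + b by rewrite {1}e divfK.
have E : (- c * t + a) * (c * g t + d) = 1 
  by rewrite mulrDl -!mulrA e' -det; ring.
have n : - c * t + a != 0.
  by apply/eqP => z; move: E; rewrite z mul0r => /esym/eqP; rewrite oner_eq0.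
split=> //; apply: (mulIf n); rewrite divfK //.
apply: (mulIf nf); rewrite -mulrA E mulr1.
by rewrite mulrDl -mulrA e' -[LHS]mulr1 -det; ring.
Qed.

Lemma mobius_on_affine f I (p q : R) : 0 < p ->
  (forall t, I t -> f t = p * t + q) -> mobius_on (ext f) I.
Proof.
move=> p0 h; apply/mobius_onP.
have s0 : Num.sqrt p != 0 by rewrite gt_eqF // sqrtr_gt0.
(* The square root normalises the determinant to 1. *)
exists (Num.sqrt p), (q / Num.sqrt p), 0, (Num.sqrt p)^-1.
rewrite mulfV // mulr0 subr0; split=> // t /h ->.
rewrite mul0r add0r invr_eq0 s0 invrK; split=> //.
by rewrite mulrDl divfK // mulrAC -expr2 sqr_sqrtr // ltW.
Qed.

(** The denominator keeps its sign on an interval, since otherwise the pole [- d / c] would lie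
    between [u] and [v]. As the determinant is 1, [f v - f u] is then [v - u] over a positive
    product of denominators. *)
Lemma mobius_on_incr f I : is_interval I -> mobius_on (ext f) I ->
  forall u v, I u -> I v -> u < v -> f u < f v.
Proof.
move=> iI /mobius_onP[a [b [c [d [det hf]]]]] u v Iu Iv uv.
have [nu ->] := hf u Iu; have [nv ->] := hf v Iv.
have pos : 0 < (c * u + d) * (c * v + d).
  rewrite lt_def mulf_neq0 //= leNgt; apply/negP => neg.
  have c0 : c != 0.
    by apply/eqP => c0; move: neg; rewrite c0 !mul0r add0r -expr2 ltNge sqr_ge0.
  have cc : 0 < c ^+ 2 by rewrite exprn_even_gt0.
  have E x : c * x + d = c * (x - - d / c) by field.
  have {}neg : (u - - d / c) * (v - - d / c) < 0.
    by move: neg; rewrite !E mulrACA -expr2 pmulr_rlt0.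
  have [] := hf (- d / c); last by rewrite E subrr mulr0 eqxx.
  apply: (iI u v Iu Iv); apply/andP; split; rewrite leNgt; apply/negP => l.
    by move: neg; rewrite ltNge mulr_ge0 // subr_ge0 ltW // (lt_trans l).
  by move: neg; rewrite ltNge mulr_le0 // subr_le0 ltW // (lt_trans uv).
rewrite -subr_gt0.
have -> : (a * v + b) / (c * v + d) - (a * u + b) / (c * u + d) =
  (a * d - b * c) * (v - u) / ((c * u + d) * (c * v + d)).
  by field; rewrite nu nv.
by rewrite det mul1r divr_gt0 // subr_gt0.
Qed.

(* Breakpoints are recorded as an unordered list, which makes stability under
   composition, inversion and gluing immediate. *)
Definition one_side I (s : R) := I `<=` [set x | x <= s] \/ I `<=` [set x | s <= x].

Definition mobius_off (s : seq R) f :=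
  forall I, {in s, forall x, one_side I x} -> mobius_on (ext f) I.

Lemma piecewise_mobius_off f :
  piecewise_mobius (ext f) -> exists s, mobius_off s f.
Proof.
move=> [n [t [tincr hl hm hr]]].
exists [seq t i | i <- iota 0 n.+1] => I hI.
have {}hI i : (i <= n)%N -> one_side I (t i).
  by move=> ilen; apply/hI/map_f; rewrite mem_iota.
have [Il|Il] := hI 0%N isT; first exact: mobius_on_sub hl.
have [Ir|Ir] := hI n (leqnn n); last exact: mobius_on_sub hr.
(* Descending from the last breakpoint, [I] either lies left of the previous one as well or is
   caught between two consecutive ones. *)
suff: forall k, (k <= n)%N -> I `<=` [set x | x <= t k] ->
    mobius_on (ext f) I by move/(_ n (leqnn n) Ir).
elim=> [_ Ik|k IH kn Ik].
  exact: mobius_on_sub hl.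
have [Ik'|Ik'] := hI k (ltnW kn); first exact: IH (ltnW kn) Ik'.
apply: mobius_on_sub (hm k kn) => x Ix /=.
by rewrite (Ik x Ix : x <= _) andbT; exact: (Ik' x Ix).
Qed.

Lemma mobius_off_piecewise s f : mobius_off s f -> piecewise_mobius (ext f).
Proof.
(* [piecewise_mobius] requires at least one breakpoint, so the harmless point 0 is added. *)
move=> hf; pose u := sort <=%R (undup (0 :: s)).
have su : sorted <%R u by rewrite sort_lt_sorted undup_uniq.
have mu x : (x \in u) = (x \in 0 :: s) by rewrite mem_sort mem_undup.
have u0 : (0 < size u)%N.
  by have := mu 0; rewrite mem_head; case: (u).
have lt_u i j : (i < j < size u)%N -> nth 0 u i < nth 0 u j.
  move=> /andP[ij ju]; rewrite (lt_sorted_ltn_nth 0 su) // inE //.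
  exact: ltn_trans ju.
have le_u i j : (i <= j < size u)%N -> nth 0 u i <= nth 0 u j.
  move=> /andP[]; rewrite leq_eqVlt => /predU1P[->//|ij ju].
  by rewrite ltW // lt_u // ij.
have hf' I : (forall i, (i < size u)%N -> one_side I (nth 0 u i)) ->
    mobius_on (ext f) I.
  move=> hI; apply: hf => x xs.
  have xu : x \in u by rewrite mu inE xs orbT.
  by rewrite -(nth_index 0 xu); apply: hI; rewrite index_mem.
exists (size u).-1, (nth 0 u); split.
- by move=> i iu; rewrite lt_u // ltnS leqnn -ltn_predRL.
- apply: hf' => i iu; left => x /= /le_trans; apply.
  by rewrite le_u.
- move=> i iu; apply: hf' => j ju; have [ji|ij] := leqP j i.
    right => x /= /andP[+ _]; apply: le_trans; rewrite le_u // ji /=.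
    by rewrite (leq_trans iu) // leq_pred.
  left => x /= /andP[_ /le_trans]; apply; rewrite le_u //.
  by rewrite ij.
- apply: hf' => i iu; right => x /=; apply: le_trans; apply: le_u.
  by rewrite -ltnS prednK // iu /=.
Qed.

End Mobius.

(** * Monod's group as a group of increasing bijections of the line *)

Section IncreasingBijection.
Context {R : realType}.
Implicit Types f g : R -> R.

Lemma finvK f : {homo f : x y / x < y} -> cancel f (finv f).
Proof.
move=> fh x; apply: pinvKV; rewrite ?in_setT // => u v _ _ e.
apply/eqP; rewrite eq_le !leNgt; apply/andP; split; apply/negP => /fh.
  by rewrite e ltxx.
by rewrite e ltxx.
Qed.

Lemma finvKV f : (forall v, exists u, f u = v) -> cancel (finv f) f.
Proof. by move=> fs v; apply: pinvK; rewrite inE; have [u] := fs v; exists u. Qed.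

Lemma homo_lt_can f g : {homo f : x y / x < y} -> cancel g f ->
  {homo g : x y / x < y}.
Proof. by move=> /le_mono/leW_mono fm gK x y xy; rewrite -fm !gK. Qed.

Lemma homo_lt_continuous f g :
  {homo f : x y / x < y} -> cancel g f -> continuous f.
Proof.
move=> fh gK x; have gh := homo_lt_can fh gK.
have fm := leW_mono (le_mono fh).
apply/cvgrPdist_lt => e e0.
have : g (f x - e) < x by rewrite -fm gK gtrBl.
have : x < g (f x + e) by rewrite -fm gK ltrDl.
move=> /lt_nbhsl hr /lt_nbhsr hl; near=> t.
rewrite ltr_distlC; apply/andP; split.
  by rewrite -[_ - e]gK fm; near: t.
by rewrite -[_ + e]gK fm; near: t.
Unshelve. all: by end_near. Qed.

Lemma homo_lt_ext_continuous f g :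
  {homo f : x y / x < y} -> cancel g f -> continuous (ext f).
Proof.
move=> fh gK [t|] V.
  exact: (homo_lt_continuous fh gK).
move=> [C [cC _] CV]; have [M [Mr hM]] := compact_bounded cC.
have fm := leW_mono (le_mono fh).
(* A neighbourhood of oo is given by the complement of a compact [C]. Points outside this segment
   are sent outside [[- (M + 1), M + 1]], which contains [C]. *)
exists `[g (- (M + 1)), g (M + 1)]%classic.
  split; first exact: segment_compact.
  exact: interval_closed.
move=> [u|] /=; last by move=> _; apply: CV; right.
move=> [|//] [w hw [uw]]; apply: CV; left; exists (f u) => //.
move=> Cfu; apply: hw; rewrite uw /= in_itv /=.
have /ler_normlP [h1 h2] : `|f u| <= M + 1 by apply: hM => //; rewrite ltrDl.
rewrite -(le_mono fh) gK -(le_mono fh u) gK h2 andbT; lra.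
Qed.

Lemma homo_lt_homeomorphism f : {homo f : x y / x < y} ->
  (forall v, exists u, f u = v) -> homeomorphism (ext f).
Proof.
move=> fh fs; have fK := finvK fh; have fKV := finvKV fs.
split; first exact: homo_lt_ext_continuous fKV.
exists (ext (finv f)); split.
- exact: homo_lt_ext_continuous (homo_lt_can fh fKV) fK.
- by case=> //= t; rewrite fK.
- by case=> //= t; rewrite fKV.
Qed.

(** Order-theoretic form of membership in [monodH], free of the topology of the projective line;
    [monodHP] proves the equivalence. *)
Definition pw_mobius_bij f := [/\ {homo f : x y / x < y},
  forall v, exists u, f u = v & exists s, mobius_off s f].

Lemma piecewise_mobius_incr f :
  piecewise_mobius (ext f) -> {homo f : x y / x < y}.
Proof.
move=> [n [t [tincr hl hm hr]]].
(* Strict monotonicity on both sides of [a] passes to the union by comparison through [f a]. *)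
have glue k (a : R) : (forall u v, u <= a -> v <= a -> u < v -> f u < f v) ->
    (forall u v, a <= u <= k -> a <= v <= k -> u < v -> f u < f v) ->
    forall u v, u <= k -> v <= k -> u < v -> f u < f v.
  move=> h1 h2 u v uk vk uv; have [va|av] := leP v a.
    by apply: h1 => //; rewrite (le_trans (ltW uv)).
  have [au|ua] := leP a u; first by apply: h2; rewrite ?au ?(ltW av).
  have ak : a <= k by rewrite (le_trans (ltW av)).
  apply: (@lt_trans _ _ (f a)); first by apply: h1 => //; exact: ltW.
  by apply: h2 => //; rewrite ?lexx ?(ltW av).
have seg k (a b : R) : mobius_on (ext f) [set x | a <= x <= b] ->
    forall u v, a <= u <= b -> a <= v <= b -> u < v -> f u < f v.
  move=> /mobius_on_incr; apply => x y /andP[ax _] /andP[_ yb] w.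
  by move=> /andP[xw wy] /=; rewrite (le_trans ax) // (le_trans wy).
have left_incr k : (k <= n)%N ->
    forall u v, u <= t k -> v <= t k -> u < v -> f u < f v.
  elim: k => [_|k IH kn].
    apply: (mobius_on_incr _ hl) => x y _ yt w /andP[_ wy] /=.
    exact: le_trans yt.
  by apply: (glue _ (t k)); [exact: IH (ltnW kn) | apply: seg => //; exact: hm].
(* The last piece is unbounded while [glue] wants a right end; any bound above [v] and [t n]
   serves. *)
move=> u v uv; apply: (glue (Num.max v (t n)) (t n)) => //.
- exact: left_incr.
- move=> u' v' /andP[tu _] /andP[tv _].
  apply: (mobius_on_incr _ hr) => // x y tx _ w /andP[xw _] /=.
  exact: le_trans xw.
- by rewrite le_max (ltW uv).
- by rewrite le_max lexx.
Qed.

Lemma monodHP f : monodH f <-> pw_mobius_bij f.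
Proof.
split=> [[[_ [G [_ _ GK]]] pf]|[fh fs [s hs]]].
  split; [exact: piecewise_mobius_incr| |exact: piecewise_mobius_off].
  by move=> v; have := GK (Some v); case: (G (Some v)) => //= u [<-]; exists u.
split; first exact: homo_lt_homeomorphism.
exact: mobius_off_piecewise hs.
Qed.

Lemma pw_mobius_bij_comp f g :
  pw_mobius_bij f -> pw_mobius_bij g -> pw_mobius_bij (f \o g).
Proof.
move=> [fh fs [sf hf]] [gh gs [sg hg]]; split.
- by move=> x y /gh/fh.
- by move=> w; have [v <-] := fs w; have [u <-] := gs v; exists u.
(* A composite breaks at the breakpoints of [g] and at the preimages under [g] of those of [f]. *)
- exists (sg ++ [seq finv g x | x <- sf]) => I hI.
  apply: mobius_on_comp; first by apply: hg => x xs; apply: hI; rewrite mem_cat xs.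
  apply: hf => x xs; have [] := hI (finv g x).
  + by rewrite mem_cat map_f // orbT.
  + move=> h; left => _ [u /h /= ux <-].
    by rewrite -(finvKV gs x) (le_mono gh).
  + move=> h; right => _ [u /h /= ux <-].
    by rewrite -(finvKV gs x) (le_mono gh).
Qed.

Lemma pw_mobius_bij_inv f : pw_mobius_bij f -> pw_mobius_bij (finv f).
Proof.
move=> [fh fs [sf hf]]; have fK := finvK fh; have fKV := finvKV fs; split.
- exact: homo_lt_can fh fKV.
- by move=> v; exists (f v).
- exists [seq f x | x <- sf] => I hI; apply: (mobius_on_inv fKV).
  apply: hf => x xs; have [h|h] := hI (f x) (map_f _ xs).
    by left => _ [u /h /= ux <-]; rewrite -(le_mono fh) fKV.
  by right => _ [u /h /= ux <-]; rewrite -(le_mono fh) fKV.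
Qed.

Lemma pw_mobius_bij_iter n f : pw_mobius_bij f -> pw_mobius_bij (iter n f).
Proof.
move=> fP; elim: n => [|n IH]; last exact: pw_mobius_bij_comp fP IH.
split=> [x y //|v|]; first by exists v.
exists [::] => I _; apply: (mobius_on_affine ltr01 (q := 0)) => t _ /=.
by rewrite mul1r addr0.
Qed.

Lemma pw_mobius_bij_affine (p q : R) : 0 < p ->
  pw_mobius_bij (fun t => p * t + q).
Proof.
move=> p0; split.
- by move=> x y xy; rewrite ltrD2r ltr_pM2l.
- by move=> v; exists ((v - q) / p); rewrite mulrC divfK ?subrK // gt_eqF.
- by exists [::] => I _; exact: mobius_on_affine p0 _.
Qed.

(** * Affine behaviour near the two ends of the line *)

Lemma mobius_on_affine_or_hyperbola f (I : set R) : mobius_on (ext f) I ->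
  (exists p q, 0 < p /\ forall t, I t -> f t = p * t + q) \/
  (exists u v, forall t, I t -> (f t - u) * (t - v) < 0).
Proof.
move=> /mobius_onP[a [b [c [d [det hf]]]]].
have [c0|c0] := eqVneq c 0; [left|right].
  move: det; rewrite c0 mulr0 subr0 => ad.
  have d0 : d != 0 by apply: contra_eq_neq ad => ->; rewrite mulr0 eq_sym oner_eq0.
  exists (d ^- 2), (b / d); split.
    by rewrite invr_gt0 exprn_even_gt0.
  move=> t /hf[_ ->]; rewrite c0 mul0r add0r mulrDl.
  have -> : a = d^-1 by apply: (mulIf d0); rewrite ad mulVf.
  by field.
(* The graph lies on a hyperbola centred at the pole [- d / c] and the value [a / c] at oo; the
   product is [- 1 / c ^+ 2]. *)
exists (a / c), (- d / c) => t /hf[n ->].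
have -> : ((a * t + b) / (c * t + d) - a / c) * (t - - d / c) =
    - (a * d - b * c) / c ^+ 2 by field; rewrite c0 n.
by rewrite det mulN1r oppr_lt0 invr_gt0 exprn_even_gt0.
Qed.

Lemma mobius_off_affine_pinfty f s : {homo f : x y / x < y} ->
  (forall v, exists u, f u = v) -> mobius_off s f ->
  exists K p q, 0 < p /\ forall t, K <= t -> f t = p * t + q.
Proof.
move=> /le_mono fm fs hf.
pose K := \big[Num.max/0]_(x <- s) x.
have [|[p [q pq]]|[u [v uv]]] := @mobius_on_affine_or_hyperbola f [set t | K <= t].
- apply: hf => x xs; right => t; apply: le_trans.
  exact: (le_bigmax_seq 0 x xpredT id xs).
- by exists K, p, q.
(* The hyperbola is impossible: by surjectivity, both factors are nonnegative at a point far enough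
   to the right. *)
- have [w fw] := fs (u + 1).
  have := uv (Num.max K (Num.max w (v + 1))).
  rewrite /= le_max lexx => /(_ isT); rewrite ltNge mulr_ge0 //.
    rewrite subr_ge0 (@le_trans _ _ (f w)) ?fw ?lerDl // -fw fm.
    by rewrite !le_max lexx orbT.
  by rewrite subr_ge0 (@le_trans _ _ (v + 1)) ?lerDl // !le_max lexx !orbT.
Qed.

Lemma mobius_off_affine_ninfty f s : {homo f : x y / x < y} ->
  (forall v, exists u, f u = v) -> mobius_off s f ->
  exists K p q, 0 < p /\ forall t, t <= K -> f t = p * t + q.
Proof.
move=> /le_mono fm fs hf.
pose K := \big[Num.min/0]_(x <- s) x.
have [|[p [q pq]]|[u [v uv]]] := @mobius_on_affine_or_hyperbola f [set t | t <= K].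
- apply: hf => x xs; left => t /= /le_trans; apply.
  exact: (ge_bigmin_seq 0 x xpredT id xs).
- by exists K, p, q.
- have [w fw] := fs (u - 1).
  have := uv (Num.min K (Num.min w (v - 1))).
  rewrite /= ge_min lexx => /(_ isT); rewrite ltNge mulr_le0 //.
    rewrite subr_le0 (@le_trans _ _ (f w)) ?fw ?gerBl // -fw fm.
    by rewrite !ge_min lexx orbT.
  by rewrite subr_le0 (@le_trans _ _ (v - 1)) ?gerBl // !ge_min lexx !orbT.
Qed.

Lemma mobius_off_glue f g s (K p q : R) : 0 < p -> mobius_off s f ->
  (forall t, t <= K -> g t = f t) -> (forall t, K <= t -> g t = p * t + q) ->
  exists s', mobius_off s' g.
Proof.
move=> p0 hf gf ga; exists (K :: s) => I hI.
have [h|h] := hI K (mem_head _ _).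
  apply: (@mobius_on_eq _ f); first by move=> t; rewrite inE => /h /gf ->.
  by apply: hf => x xs; apply: hI; rewrite inE xs orbT.
by apply: (mobius_on_affine p0 (q := q)) => t /h /ga.
Qed.

End IncreasingBijection.

(** * Orbits of maps lying below the identity *)

Section Iterates.
Context {R : realType}.
Implicit Types f g y z : R -> R.

Lemma iter_homo_lt n f : {homo f : u v / u < v} -> {homo iter n f : u v / u < v}.
Proof. by move=> fh u v uv; elim: n => //= n; exact: fh. Qed.

Lemma iter_can n f g : cancel f g -> cancel (iter n f) (iter n g).
Proof. by move=> fK t; elim: n => //= n IH; rewrite -iterS iterSr fK. Qed.

Lemma iter_intertwine n y h z : (forall t, h (z t) = y (h t)) ->
  forall t, h (iter n z t) = iter n y (h t).
Proof. by move=> hz t; elim: n => //= n <-. Qed.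

Lemma iter_le f (t : R) m n : (forall u, f u < u) -> (m <= n)%N ->
  iter n f t <= iter m f t.
Proof.
move=> fl /subnK <-; rewrite iterD; elim: (n - m)%N => //= k.
exact/le_trans/ltW.
Qed.

(** Otherwise the orbit has an infimum [f u] with [f u < u]; some orbit point lies below [u], and
    its image falls below the infimum. *)
Lemma iter_unbounded f (t M : R) : {homo f : u v / u < v} ->
  (forall v, exists u, f u = v) -> (forall u, f u < u) ->
  exists n, iter n f t <= M.
Proof.
move=> fh fs fl; apply: contrapT => /forallNP nM.
pose E := [set iter n f t | n in setT].
have Ei : has_inf E.
  split; first by exists t, 0%N.
  by exists M => _ [n _ <-]; rewrite leNgt; apply/negP => /ltW /nM.
have [u fu] := fs (inf E).
have : inf E < u by rewrite -fu.
move=> /(inf_lt Ei.1)[_ [n _ <-]] /fh; rewrite fu => lt.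
suff : inf E <= f (iter n f t) by rewrite leNgt lt.
by apply: ge_inf; [have [] := Ei | exists n.+1].
Qed.

Lemma iter_inv_unbounded f (t M : R) : {homo f : u v / u < v} ->
  (forall v, exists u, f u = v) -> (forall u, f u < u) ->
  exists n, M <= iter n (finv f) t.
Proof.
move=> fh fs fl; have [n hn] := iter_unbounded M t fh fs fl; exists n.
by rewrite -(le_mono (iter_homo_lt n fh)) (iter_can n (finvKV fs)).
Qed.

(** Orbits descend, hence never leave the half-line where [f] is affine, and each step scales
    differences by [s]. *)
Lemma iter_affine_sub f (s b L : R) : (forall u, f u < u) ->
  (forall u, u <= L -> f u = s * u + b) ->
  forall n u v, u <= L -> v <= L -> iter n f u - iter n f v = s ^+ n * (u - v).
Proof.
move=> fl fa n u v uL vL; elim: n => [|n IH]; first by rewrite expr0 mul1r.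
rewrite /= !fa ?(le_trans (iter_le _ fl (leq0n n))) //.
by rewrite exprS -mulrA -IH; ring.
Qed.

(** A slope below 1 would give the affine part the fixed point [b / (1 - s)], to the left of which
    it does not decrease points. *)
Lemma slope_ge1 f (s b L : R) : (forall u, f u < u) ->
  (forall u, u <= L -> f u = s * u + b) -> 1 <= s.
Proof.
move=> fl fa; rewrite leNgt; apply/negP => s1.
have s1' : 0 < 1 - s by rewrite subr_gt0.
pose t := Num.min L (b / (1 - s)).
have tL : t <= L by rewrite ge_min lexx.
have : t <= b / (1 - s) by rewrite ge_min lexx orbT.
rewrite ler_pdivlMr // => h.
have := fl t; rewrite fa //; lra.
Qed.

(** With slope at least 1 the downward displacement cannot shrink along the orbit, so every step
    descends by at least the first one, [e]. *)
Lemma iter_affine_unbounded (s b u M : R) : 1 <= s -> s * u + b < u ->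
  exists n, iter n (fun x => s * x + b) u <= M.
Proof.
move=> s1 lu; pose e := u - (s * u + b).
have e0 : 0 < e by rewrite subr_gt0.
have le n : iter n (fun x => s * x + b) u <= u - n%:R * e.
  elim: n => [|n IH] /=; first by rewrite mul0r subr0.
  have ne : 0 <= n%:R * e by rewrite mulr_ge0 // ltW.
  have /= h : s * iter n (fun x => s * x + b) u <= s * (u - n%:R * e).
    by rewrite ler_pM2l // (lt_le_trans ltr01).
  have h2 : n%:R * e <= s * (n%:R * e) by rewrite ler_peMl.
  rewrite -natr1 mulrDl mul1r {2}/e; lra.
exists (Num.truncn ((u - M) / e)).+1; apply: le_trans (le _) _.
have := truncnS_gt ((u - M) / e).
by rewrite ltr_pdivrMr // => h; lra.
Qed.

End Iterates.

(** * From a conjugator to a normalised germ and affinity in the final box *)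

Section Conjugacy.
Context {R : realType} (y z : R -> R).
Hypotheses (yP : pw_mobius_bij y) (zP : pw_mobius_bij z).
Hypotheses (yl : forall t, y t < t) (zl : forall t, z t < t).

(* Replacing the conjugator [g] by [y^n g] pushes its germ down, which gives the
   normalisation [p * L + q <= L]. *)
Lemma conjugator_normalized (g : R -> R) (L : R) : initial_box y z L ->
  pw_mobius_bij g -> (forall t, g (z t) = y (g t)) ->
  exists h T p q, [/\ pw_mobius_bij h, forall t, h (z t) = y (h t), 0 < p,
    forall t, t <= T -> h t = p * t + q & p * L + q <= L].
Proof.
move=> [s [b [c yz]]] gP gz.
have ya t : t <= L -> y t = s * t + b by move=> tL; have [] := yz t.
have za t : t <= L -> z t = s * t + c by move=> tL; have [] := yz t.
have s1 := slope_ge1 yl ya; have s0 : 0 < s := lt_le_trans ltr01 s1.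
have [gh gs [sg hg]] := gP.
have [T [p [q [p0 ga]]]] := mobius_off_affine_ninfty gh gs hg.
have com : s * q + b = p * c + q.
  (* So far left, [g] is affine at [t] and [z t], and [y] is affine at [g t]; [g z = y g] then
     compares the affine germs. *)
  pose t := Num.min T (Num.min L ((L - q) / p)).
  have tT : t <= T by rewrite ge_min lexx.
  have tL : t <= L by rewrite !ge_min lexx orbT.
  have : t <= (L - q) / p by rewrite !ge_min lexx !orbT.
  rewrite ler_pdivlMr // => tq.
  have := gz t; rewrite za // ga; last by rewrite -za // (le_trans (ltW (zl t))).
  rewrite ga // ya; lra.
(* The point [p * L + q] may lie above [L], where [y] need not be affine. By [com], the inequality
   is the image of [z L < L] under the affine germ of [g]. *)
have ul : s * (p * L + q) + b < p * L + q.
  have -> : s * (p * L + q) + b = p * (s * L + c) + q by lra.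
  by rewrite ltrD2r ltr_pM2l // -za.
have [n hn] := iter_affine_unbounded L s1 ul.
exists (iter n y \o g).
suff [T' [p' [q' [p'0 ha e]]]] : exists T' p' q', [/\ 0 < p',
    forall t, t <= T' -> iter n y (g t) = p' * t + q' &
    p' * L + q' = iter n (fun x => s * x + b) (p * L + q)].
  exists T', p', q'; split=> //; last by rewrite e.
    exact: pw_mobius_bij_comp (pw_mobius_bij_iter n yP) gP.
  by move=> t /=; rewrite gz -iterSr.
elim: n {hn} => [|n [T' [p' [q' [p'0 ha e]]]]]; first by exists T, p, q.
(* The second bound keeps [p' * t + q'] below [L], where [y] is affine. *)
exists (Num.min T' ((L - q') / p')), (s * p'), (s * q' + b).
split; [by rewrite mulr_gt0| |by rewrite /= -e; ring].
move=> t; rewrite le_min => /andP[tT']; rewrite ler_pdivlMr // => tq /=.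
by rewrite ha // ya; lra.
Qed.

Lemma conjugator_affine_final (h : R -> R) (r : R) : final_box y z r ->
  pw_mobius_bij h -> (forall t, h (z t) = y (h t)) ->
  affine_inside (upper_square r) h.
Proof.
move=> [s [b [c yz]]] [hh hs [sh hP]] hz.
have yz' t : r <= t -> y t = s * t + b /\ z t = s * t + c.
  by move=> rt; apply: yz; rewrite /= in_itv /= rt.
have [K [p [q [p0 ha]]]] := mobius_off_affine_pinfty hh hs hP.
have [zh zs _] := zP; have hm := le_mono hh; have zm := le_mono zh.
have com : s * q + b = p * c + q.
  pose t := Num.max (Num.max r K) (Num.max (finv z K) (finv h r)).
  have tr : r <= t by rewrite !le_max lexx.
  have tK : K <= t by rewrite !le_max lexx !orbT.
  have tz : K <= z t by rewrite -(finvKV zs K) zm !le_max lexx !orbT.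
  have th : r <= h t by rewrite -(finvKV hs r) hm !le_max lexx !orbT.
  have := hz t; rewrite (yz' (h t) th).1 ha // ha // (yz' t tr).2; lra.
exists p, q => t [/=]; rewrite !in_itv /= !andbT.
(* Induction on the number of backward steps needed to pass [K]. Moving from [t] to [finv z t] goes
   right, so it stays in the final box, and [com] carries the formula back to [t]. *)
have [n] := iter_inv_unbounded t K zh zs zl.
elim: n t => [|n IH] t; first by move=> /ha.
rewrite iterSr => Kt rt rht.
have tu : t < finv z t by rewrite -{1}(finvKV zs t).
have ru : r <= finv z t by rewrite (le_trans rt) // ltW.
have rhu : r <= h (finv z t) by rewrite (le_trans rht) // hm ltW.
have hu := IH _ Kt ru rhu.
rewrite -{1 2}(finvKV zs t) hz (yz' _ rhu).1 hu (yz' _ ru).2; lra.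
Qed.

End Conjugacy.

(** * The limit of the approximants as a conjugator *)

Section LimitConjugator.
Context {R : realType} (y z : R -> R) (L a b : R).
Hypotheses (yP : pw_mobius_bij y) (zP : pw_mobius_bij z).
Hypotheses (yl : forall t, y t < t) (zl : forall t, z t < t).
Hypotheses (yzL : initial_box y z L) (a0 : a != 0).

Let g0 (t : R) := a ^+ 2 * t + a * b.
Hypothesis cvg0 : forall t, cvgn (conj_seq y g0 z t).
Let gam t := limn (conj_seq y g0 z t).

Let yh : {homo y : u v / u < v}. Proof. by case: yP. Qed.
Let ys : forall v, exists u, y u = v. Proof. by case: yP. Qed.
Let zh : {homo z : u v / u < v}. Proof. by case: zP. Qed.
Let zs : forall v, exists u, z u = v. Proof. by case: zP. Qed.
Let a2 : 0 < a ^+ 2. Proof. by rewrite exprn_even_gt0. Qed.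

(** The sequence at [z t] is [y] applied to the shifted sequence at [t], and [y] is continuous. *)
Lemma lim_conj_seq_intertwine t : gam (z t) = y (gam t).
Proof.
apply: cvg_lim => //.
have -> : conj_seq y g0 z (z t) = y \o (fun n => conj_seq y g0 z t n.+1).
  by apply/funext => n; rewrite /conj_seq /= -iterSr (finvKV ys).
apply: continuous_cvg; first exact: homo_lt_continuous yh (finvKV ys) _.
by rewrite (cvg_shiftS (conj_seq y g0 z t)); exact: cvg0.
Qed.

Lemma lim_conj_seq_homo : {homo gam : u v / u <= v}.
Proof.
move=> u v uv; apply: ler_lim; [exact: cvg0|exact: cvg0|].
apply: nearW => n; rewrite /conj_seq.
rewrite (le_mono (iter_homo_lt n (homo_lt_can yh (finvKV ys)))).
by rewrite /g0 lerD2r ler_pM2l // (le_mono (iter_homo_lt n zh)).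
Qed.

Lemma lim_conj_seq_iter n t : gam (iter n z t) = iter n y (gam t).
Proof. exact: (iter_intertwine n lim_conj_seq_intertwine). Qed.

(* Far to the left the approximants eventually stay in the initial box, where
   conjugating by affine maps of equal slope does not change the slope of [g0]. *)
Lemma lim_conj_seq_affine_ninfty :
  exists T c, forall t, t <= T -> gam t = a ^+ 2 * t + c.
Proof.
have [s [by_ [bz yz]]] := yzL.
have ya t : t <= L -> y t = s * t + by_ by move=> tL; have [] := yz t.
have za t : t <= L -> z t = s * t + bz by move=> tL; have [] := yz t.
have s0 : 0 < s := lt_le_trans ltr01 (slope_ge1 yl ya).
(* The margin [L - 1] makes [gam T < L] strict, so that the approximants themselves are eventually
   below [L]. *)
have [n hn] := iter_unbounded (gam L) (L - 1) yh ys yl.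
pose T := iter n z L.
have TL : T <= L := iter_le L zl (leq0n n).
have gT : gam T < L by rewrite lim_conj_seq_iter (le_lt_trans hn) // gtrBl.
exists T, (gam T - a ^+ 2 * T) => t tT.
suff : gam t - gam T = a ^+ 2 * (t - T) by lra.
have gt : gam t < L := le_lt_trans (lim_conj_seq_homo tT) gT.
have cvgtT : conj_seq y g0 z t n - conj_seq y g0 z T n @[n --> \oo]
    --> gam t - gam T by apply: cvgB; exact: cvg0.
have ltL u : gam u < L -> \forall n \near \oo, conj_seq y g0 z u n < L.
  by move=> uL; apply: cvgr_lt uL; exact: cvg0.
rewrite -(cvg_lim _ cvgtT) //; apply: lim_near_cst => //.
have tlt := ltL t gt; have Tlt := ltL T gT; near=> N.
have wt : conj_seq y g0 z t N <= L by apply/ltW; near: N.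
have wT : conj_seq y g0 z T N <= L by apply/ltW; near: N.
have sN : s ^+ N != 0 by rewrite expf_neq0 // gt_eqF.
(* Multiplication by [s ^+ N] amounts to applying [y^N], which cancels [y^-N]; what remains is [g0]
   on the [z]-orbits, whose difference has the same factor. *)
apply: (mulfI sN).
rewrite -(iter_affine_sub yl ya) // /conj_seq !(iter_can N (finvKV ys)) /g0.
have tL := le_trans tT TL.
have := iter_affine_sub zl za N tL TL; rewrite mulrCA => <-; ring.
Unshelve. all: by end_near. Qed.

Lemma lim_conj_seq_pw_mobius_bij r :
  affine_inside (upper_square r) gam -> pw_mobius_bij gam.
Proof.
move=> [p [q gr]]; have [T [c ga]] := lim_conj_seq_affine_ninfty.
have gh : {homo gam : u v / u < v}.
  (* Limits preserve only weak order; strictness is recovered by pushing both points by [z^n] to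
     where [gam] is affine of positive slope. *)
  move=> u v uv; have [n hn] := iter_unbounded v T zh zs zl.
  rewrite -(leW_mono (le_mono (iter_homo_lt n yh))) -!lim_conj_seq_iter.
  have zuv := iter_homo_lt n zh uv.
  by rewrite !ga // ?ltrD2r ?ltr_pM2l // (le_trans (ltW zuv)).
have gs v : exists u, gam u = v.
  have [n hn] := iter_unbounded v (a ^+ 2 * T + c) yh ys yl.
  exists (iter n (finv z) ((iter n y v - c) / a ^+ 2)).
  apply: (can_inj (iter_can n (finvK yh))).
  rewrite -lim_conj_seq_iter (iter_can n (finvKV zs)) ga; first by field.
  by rewrite ler_pdivrMr //; lra.
(* Beyond [K] both [t] and [gam t] are at least [r], so the graph is in the final box. *)
have [w gw] := gs r; pose K := Num.max r w.
have rK t : K <= t -> gam t = p * t + q.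
  rewrite ge_max => /andP[rt wt]; apply: gr.
  by split; rewrite /= in_itv /= andbT // -gw (le_mono gh).
have p0 : 0 < p.
  have : gam K < gam (K + 1) by apply: gh; rewrite ltrDl.
  by rewrite !rK ?lerDl //; lra.
(* By monotonicity of [z^n], one [n] serves all [t <= K]; there [gam] is the composite below, which
   has finitely many breakpoints. *)
have [n hn] := iter_unbounded K T zh zs zl.
have [_ _ [s hs]] : pw_mobius_bij
    (iter n (finv y) \o ((fun t => a ^+ 2 * t + c) \o iter n z)).
  apply: pw_mobius_bij_comp; first exact/pw_mobius_bij_iter/pw_mobius_bij_inv.
  by apply: pw_mobius_bij_comp (pw_mobius_bij_affine _ a2) (pw_mobius_bij_iter _ _).
split=> //; apply: (mobius_off_glue p0 hs _ rK) => t tK /=.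
rewrite -ga; last by rewrite (le_trans _ hn) // (le_mono (iter_homo_lt n zh)).
by rewrite lim_conj_seq_iter (iter_can n (finvK yh)).
Qed.

End LimitConjugator.

(** * Independence of the choice of [g0], and the criterion for conjugacy *)

Lemma conj_seq_cvg (R : realType) (y z g0 h : R -> R) (T : R) :
  pw_mobius_bij y -> pw_mobius_bij z -> (forall t, z t < t) ->
  (forall t, h (z t) = y (h t)) -> (forall t, t <= T -> g0 t = h t) ->
  forall t, conj_seq y g0 z t @ \oo --> h t.
Proof.
move=> [yh ys _] [zh zs _] zl hz gh t; apply: cvg_near_cst.
have [n hn] := iter_unbounded t T zh zs zl.
exists n => // N /= nN; rewrite /conj_seq gh.
  by rewrite (iter_intertwine N hz) (iter_can N (finvK yh)).
exact: le_trans (iter_le t zl nN) hn.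
Qed.

Theorem corollary3p17 (R : realType) (y z : R -> R) (L r : R)
    (Hy : monodH_lt y) (Hz : monodH_lt z)
    (HL : initial_box y z L) (Hr : final_box y z r) :
  (exists g : R -> R, monodH g /\ finv g \o y \o g = z)
  <->
  (exists a b : R,
    [/\ a != 0,
        a ^+ 2 * L + a * b <= L &
        forall g0 : R -> R,
          monodH g0 ->
          affine_inside (lower_square L) g0 ->
          has_initial_germ g0 (a ^+ 2, a * b) ->
          (forall t : R, cvgn (conj_seq y g0 z t)) /\
          affine_inside (upper_square r)
            (fun t : R => limn (conj_seq y g0 z t)) ]).
Proof.
have [/monodHP yP yl] := Hy; have [/monodHP zP zl] := Hz.
split=> [[g [/monodHP gP zE]]|[a [b [a0 _ H]]]].
  have gz t : g (z t) = y (g t).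
    by have [_ gs _] := gP; rewrite -zE /= (finvKV gs).
  have [h [T [p [q [hP hz p0 ha pqL]]]]] := conjugator_normalized yP yl zl HL gP gz.
  have sp0 : Num.sqrt p != 0 by rewrite gt_eqF // sqrtr_gt0.
  have sp2 : Num.sqrt p ^+ 2 = p by rewrite sqr_sqrtr // ltW.
  have spq : Num.sqrt p * (q / Num.sqrt p) = q by rewrite mulrC divfK.
  (* Chosen so that [a ^+ 2] is [p] and [a * b] is [q], the germ of the normalised conjugator. *)
  exists (Num.sqrt p), (q / Num.sqrt p); rewrite sp2 spq; split=> // g0 _ _.
  move=> [_ [M [_ /= g0M]]].
  have g0h t : t <= Num.min T (M - 1) -> g0 t = h t.
    rewrite le_min => /andP[tT tM]; rewrite ha // g0M //.
    by rewrite (le_lt_trans tM) // gtrBl.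
  have hlim := conj_seq_cvg yP zP zl hz g0h.
  split=> [t|]; first by apply/cvg_ex; exists (h t).
  have -> : (fun t => limn (conj_seq y g0 z t)) = h.
    by apply/funext => t; apply: cvg_lim.
  exact: (conjugator_affine_final zP zl Hr hP hz).
have a2 : 0 < a ^+ 2 by rewrite exprn_even_gt0.
(* The globally affine map with the prescribed germ is an admissible [g0]. *)
have [||| cv ai] := H (fun t => a ^+ 2 * t + a * b).
- exact/monodHP/pw_mobius_bij_affine.
- by exists (a ^+ 2), (a * b).
- by split=> //; exact: nearW.
have gP := lim_conj_seq_pw_mobius_bij yP zP yl zl HL a0 cv ai.
(* The conjugator is the limit map itself. *)
eexists; split; first exact/monodHP/gP.
have [gh _ _] := gP; apply/funext => t /=.
by rewrite -(lim_conj_seq_intertwine yP cv) (finvK gh).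
Qed.
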